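(* Let $A$ be a regular system of divisors and $n\in\mathbb N$. Then \[ \Phi_{A,n}(x)=\prod_{\substack{d\mid n\\ \gamma_A(n)\mid d}}\Phi_d(x), \] where $\Phi_d(x)$ is the classical $d$-th cyclotomic polynomial.
   Context: A regular system of divisors is a family $A=(A(n))_{n\in\mathbb N}$, where each $A(n)$ is a set of positive divisors of $n$, such that: (i) $A(1)=\{1\}$ and $A(mn)=\{de: d\in A(m), e\in A(n)\}$ whenever $\gcd(m,n)=1$; (ii) for every prime power $p^a$ ($a\ge1$) there is a divisor $t=t_A(p^a)$ of $a$ (the type of $p^a$) such that $A(p^{it})=\{1,p^t,\dots,p^{it}\}$ for every $0\le i\le a/t$. For $j\in\mathbb Z$, $(j,n)_A=\max\{d\in\mathbb N: d\mid j,\ d\in A(n)\}$; $\zeta_n=e^{2\pi i/n}$; $\Phi_{A,n}(x)=\prod_{1\le j\le n,\ (j,n)_A=1}(x-\zeta_n^j)$. The $A$-core is $\gamma_A(n)=\prod_{p^a\parallel n}p^{a-t_A(p^a)+1}$, the product over the prime powers exactly dividing $n$. *)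

(* Defs.v *)
From mathcomp Require Import all_boot all_order all_algebra.
From mathcomp Require Import finmap.
From mathcomp Require Import cyclotomic complex.
From mathcomp Require Import reals trigo.

Set Implicit Arguments.
Unset Strict Implicit.
Unset Printing Implicit Defensive.

Import GRing.Theory.
Local Open Scope fset_scope.
Local Open Scope ring_scope.
Local Open Scope complex_scope.

(* Families are indexed by all of nat; the value [A 0] is never constrained
   nor used. *)
Definition divisor_family := nat -> {fset nat}.

Definition has_type (A : divisor_family) (p a t : nat) : bool :=
  (t %| a)%N &&
  [forall i : 'I_(a %/ t).+1,
     A (p ^ (i * t))%N == [fset (p ^ (k * t))%N | k in iota 0 i.+1]].

Record regular_system (A : divisor_family) : Prop := RegularSystem {
  regular_dvd : forall n d : nat, (0 < n)%N -> d \in A n -> (d %| n)%N;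
  regular1 : A 1%N = [fset 1%N];
  regularM : forall m n : nat, (0 < m)%N -> (0 < n)%N -> coprime m n ->
    A (m * n)%N = [fset (d * e)%N | d in A m, e in A n];
  regular_pfactor : forall p a : nat, prime p -> (0 < a)%N ->
    exists t : nat, has_type A p a t
}.

(* [p ^ a] has at most one type, so picking the first one is no choice: see
   [has_type_uniq] and [type_ofP] below. *)
Definition type_of (A : divisor_family) (p a : nat) : nat :=
  head 0%N [seq t <- divisors a | has_type A p a t].

Definition gcdA (A : divisor_family) (j : int) (n : nat) : nat :=
  (\max_(d <- A n | (d%:Z %| j)%Z) d)%N.

Definition coreA (A : divisor_family) (n : nat) : nat :=
  (\prod_(p <- primes n) p ^ (logn p n - type_of A p (logn p n) + 1))%N.

(* e^(2 pi i / n) *)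
Definition zeta (R : realType) (n : nat) : R[i] :=
  cos (2 * pi / n%:R) +i* sin (2 * pi / n%:R).

Definition cyclotomicA (R : realType) (A : divisor_family) (n : nat) :
    {poly R[i]} :=
  \prod_(1 <= j < n.+1 | gcdA A j%:Z n == 1%N) ('X - (zeta R n ^+ j)%:P).

Lemma type_ofP A p a : regular_system A -> prime p -> (0 < a)%N ->
  has_type A p a (type_of A p a).
Proof.
move=> rA p_pr a_gt0; have [t ht] := regular_pfactor rA p_pr a_gt0.
have : t \in [seq u <- divisors a | has_type A p a u].
  by rewrite mem_filter ht -dvdn_divisors //; case/andP: ht.
rewrite /type_of; case E: [seq _ <- _ | _] => [//|u s] _ /=.
have : u \in [seq u <- divisors a | has_type A p a u] by rewrite E mem_head.
by rewrite mem_filter => /andP[].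
Qed.

Lemma has_type_uniq A p a t u : prime p -> (0 < a)%N ->
  has_type A p a t -> has_type A p a u -> t = u.
Proof.
move=> p_pr a_gt0.
suff le v w : has_type A p a v -> has_type A p a w -> (w %| v)%N.
  by move=> ht hu; apply/eqP; rewrite eqn_dvd !le.
have Aa x : has_type A p a x ->
    A (p ^ a)%N = [fset (p ^ (k * x))%N | k in iota 0 (a %/ x).+1].
  by case/andP=> xa /forallP/(_ ord_max)/eqP/=; rewrite divnK.
move=> hv hw; have/andP[va _] := hv.
have : (p ^ v)%N \in A (p ^ a)%N.
  rewrite (Aa _ hv); apply/imfsetP => /=.
  have v_gt0 : (0 < v)%N := dvdn_gt0 a_gt0 va.
  have k1 : 1%N \in iota 0 (a %/ v).+1.
    rewrite mem_iota; apply/andP; split=> //.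
    by rewrite add0n ltnS divn_gt0 // dvdn_leq.
  by exists 1%N => //; rewrite mul1n.
rewrite (Aa _ hw) => /imfsetP[/= k _ /eqP].
by rewrite eqn_exp2l ?prime_gt1 // => /eqP->; rewrite dvdn_mull.
Qed.

(* Main.v *)
Require Import Defs.
From mathcomp Require Import all_boot all_order all_algebra.
From mathcomp Require Import finmap cyclotomic complex reals.
From mathcomp Require Import unstable trigo zify lra.

(** Write [t p] for the type of the exact power of [p] dividing [n]. By
    multiplicativity an element of [A n] divisible by [p] is divisible by
    [p ^ t p], and [p ^ t p] lies in [A n]; hence [gcdA A j n = 1] iff no
    [p ^ t p] divides [j]. Comparing [p]-adic valuations, this says that
    [coreA A n] divides [n %/ gcdn j n], the order of [zeta R n ^+ j].
    Grouping the roots of [cyclotomicA R A n] by their order gives the claim. *)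

Import Order.TTheory GRing.Theory Num.Theory.

Local Open Scope ring_scope.

(** * The complex exponential as a primitive root of unity *)

Lemma exprn_cos_sin (R : realType) (x : R) (k : nat) :
  (cos x +i* sin x)%C ^+ k = (cos (k%:R * x) +i* sin (k%:R * x))%C.
Proof.
elim: k => [|k IHk]; first by rewrite expr0 mul0r cos0 sin0.
rewrite exprS IHk -natr1 mulrDl mul1r addrC cosD sinD.
by apply/eqP; rewrite eq_complex /= eqxx addrC eqxx.
Qed.

(** By the half-angle formula [cos x = 1 - 2 sin(x/2)^2], and [sin] is positive on the open interval
    from 0 to [pi]. *)
Lemma cos_eq1_lt2pi (R : realType) (x : R) :
  0 <= x < pi *+ 2 -> (cos x == 1) = (x == 0).
Proof.
move=> /andP[x_ge0 x_lt]; apply/eqP/eqP => [|->]; last exact: cos0.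
have {1}-> : x = (x / 2) *+ 2 by rewrite -mulr_natr divfK // pnatr_eq0.
rewrite cos_mulr2n cos2sin2 => cos1; apply/eqP; case: eqVneq => // x_neq0.
have x_gt0 : 0 < x by rewrite lt_def x_neq0.
have /sin_gt0_pi : 0 < x / 2 < pi.
  by rewrite divr_gt0 //= ltr_pdivrMr // mulr_natr.
suff -> : sin (x / 2) = 0 by rewrite ltxx.
by apply/eqP; rewrite -sqrf_eq0; apply/eqP; lra.
Qed.

Lemma zeta_prim_root (R : realType) (n : nat) :
  (0 < n)%N -> n.-primitive_root (zeta R n).
Proof.
move=> n_gt0; rewrite /primitive_root_of_unity n_gt0; apply/forallP => i.
rewrite unity_rootE /zeta exprn_cos_sin eq_complex /=.
have n_neq0 : n%:R != 0 :> R by rewrite pnatr_eq0 -lt0n.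
case: (eqVneq i.+1 n) => [->|ni].
  have -> : n%:R * (2 * pi / n%:R) = pi *+ 2 :> R.
    by rewrite mulrC divfK // mulr_natl.
  by rewrite cos2pi sin2pi !eqxx.
have i_lt : (i.+1 < n)%N by rewrite ltn_neqAle ni ltn_ord.
have x_gt0 : 0 < i.+1%:R * (2 * pi / n%:R) :> R.
  by rewrite !(mulr_gt0, pi_gt0, invr_gt0) ?ltr0n.
(* For [i.+1 < n] the angle lies strictly between 0 and [2 * pi], so the real part alone already
   differs from 1. *)
rewrite cos_eq1_lt2pi ?(gt_eqF x_gt0) // (ltW x_gt0) /= mulrA.
rewrite ltr_pdivrMr ?ltr0n // -[pi *+ 2]mulr_natl mulrC.
by rewrite ltr_pM2l ?ltr_nat // mulr_gt0 ?pi_gt0.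
Qed.

(** * Cyclotomic polynomials and the order of their roots *)

(** Both families factor ['X^n - 1] over the divisors of [n]. By strong induction the factors at
    proper divisors agree; their product is monic, hence can be cancelled. *)
Lemma map_Cyclotomic (F : numFieldType) (n : nat) (z : F) :
  n.-primitive_root z -> map_poly intr 'Phi_n = cyclotomic z n.
Proof.
elim/ltn_ind: n z => n IHn z prim_z.
have n_gt0 := prim_order_gt0 prim_z.
have n_div : n \in divisors n by rewrite -dvdn_divisors.
have := prod_cyclotomic prim_z.
have <- : map_poly (intr : int -> F) ('X^n - 1) = 'X^n - 1.
  by rewrite rmorphB rmorph1 /= map_polyXn.
rewrite -prod_Cyclotomic // rmorph_prod /= !(big_rem n n_div) /=.
rewrite divnn n_gt0 expr1 [X in _ * X = _](_ : _ =
  \prod_(d <- rem n (divisors n)) cyclotomic (z ^+ (n %/ d)) d).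
  apply/mulIf/monic_neq0/monic_prod => d _; exact: cyclotomic_monic.
apply: eq_big_seq => d.
rewrite mem_rem_uniq ?divisors_uniq // inE -dvdn_divisors // => /andP[d_n d_dv].
by apply/IHn/dvdn_prim_root => //; rewrite ltn_neqAle d_n dvdn_leq.
Qed.

(** With [q = n %/ d], the map [k |-> q * k] is a bijection from the exponents below [d] coprime to
    [d] onto the exponents below [n] whose gcd with [n] is [q]. *)
Lemma cyclotomic_exp_divn (R : comNzRingType) (z : R) (n d : nat) :
  (0 < n)%N -> (d %| n)%N ->
  cyclotomic (z ^+ (n %/ d)) d =
  \prod_(k < n | (n %/ gcdn k n)%N == d) ('X - (z ^+ k)%:P).
Proof.
move=> n_gt0 d_dv; set q := (n %/ d)%N.
have nE : n = (q * d)%N by rewrite divnK.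
have /andP[q_gt0 d_gt0] : (0 < q)%N && (0 < d)%N by rewrite -muln_gt0 -nE.
have h_lt (k : 'I_d) : (q * k < n)%N by rewrite nE ltn_pmul2l.
have h'_lt (k : 'I_n) : (k %/ q < d)%N by rewrite ltn_divLR // mulnC -nE.
rewrite (reindex_onto (fun k => Ordinal (h_lt k)) (fun k => Ordinal (h'_lt k))).
  apply: eq_big => [k|k _]; last by rewrite exprM.
  rewrite -val_eqE /= mulKn // eqxx andbT nE -muln_gcdr divnMl //.
  have g_gt0 : (0 < gcdn k d)%N by rewrite gcdn_gt0 d_gt0 orbT.
  rewrite -(eqn_pmul2r g_gt0) divnK ?dvdn_gcdr //.
  by rewrite -[X in X == _]muln1 eqn_pmul2l // eq_sym.
move=> k /eqP gE; apply: val_inj; rewrite /= mulnC divnK //.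
suff -> : q = gcdn k n by exact: dvdn_gcdl.
apply/eqP; rewrite -(eqn_pmul2r d_gt0) -nE; apply/eqP.
by rewrite -gE mulnC divnK ?dvdn_gcdr.
Qed.

(** After exchanging the two products, each exponent [k] occurs for exactly one divisor,
    [d = n %/ gcdn k n]. *)
Lemma prod_cyclotomic_cond (R : comNzRingType) (z : R) (n : nat)
    (P : pred nat) : (0 < n)%N ->
  \prod_(d <- divisors n | P d) cyclotomic (z ^+ (n %/ d)) d =
  \prod_(k < n | P (n %/ gcdn k n)%N) ('X - (z ^+ k)%:P).
Proof.
move=> n_gt0.
transitivity (\prod_(d <- divisors n | P d)
    \prod_(k < n | (n %/ gcdn k n)%N == d) ('X - (z ^+ k)%:P)).
  rewrite big_seq_cond [RHS]big_seq_cond; apply: eq_bigr => d.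
  by rewrite -dvdn_divisors // => /andP[d_dv _]; apply: cyclotomic_exp_divn.
rewrite (exchange_big_dep (fun k : 'I_n => P (n %/ gcdn k n)%N)) /=; last first.
  by move=> d k Pd /eqP ->.
apply: eq_bigr => k Pk.
have k_div : (n %/ gcdn k n)%N \in divisors n.
  rewrite -dvdn_divisors //.
  by rewrite -[X in (_ %| X)%N](divnK (dvdn_gcdr k n)) dvdn_mulr.
rewrite (big_rem _ k_div) /= Pk eqxx /= big_seq_cond big_pred0 ?mulr1 // => d.
rewrite mem_rem_uniq ?divisors_uniq // inE eq_sym.
by case: eqP; rewrite ?andbF.
Qed.

(** * Divisibility in a regular system, one prime at a time *)

Section RegularSystem.

Variable A : divisor_family.
Hypothesis rA : regular_system A.

Lemma type_of_bounds (p a : nat) :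
  prime p -> (0 < a)%N -> (0 < type_of A p a <= a)%N.
Proof.
move=> p_pr a_gt0; have /andP[t_dv _] := type_ofP rA p_pr a_gt0.
by rewrite (dvdn_gt0 a_gt0 t_dv) dvdn_leq.
Qed.

Lemma mem_pfactorP (p a d : nat) : prime p -> (0 < a)%N ->
  reflect (exists2 k, (k <= a %/ type_of A p a)%N &
                      d = (p ^ (k * type_of A p a))%N)
          (d \in A (p ^ a)%N).
Proof.
move=> p_pr a_gt0.
(* The index [ord_max] is [i = a %/ t], for which [p ^ (i * t)] is [p ^ a] itself. *)
have /andP[t_dv /forallP/(_ ord_max)/eqP/=] := type_ofP rA p_pr a_gt0.
rewrite divnK // => ->.
apply: (iffP (imfsetP _ _ _ _)) => -[k /= k_le ->]; exists k => //.
  by have : k \in iota 0 (a %/ type_of A p a).+1 := k_le; rewrite mem_iota.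
by change (k \in iota 0 (a %/ type_of A p a).+1); rewrite mem_iota.
Qed.

Lemma regular_partn (n p : nat) : (0 < n)%N ->
  A n = [fset (d * e)%N | d in A (n`_p)%N, e in A (n`_p^')%N]%fset.
Proof.
move=> n_gt0; rewrite -{1}(partnC p n_gt0).
by rewrite (regularM rA) ?part_gt0 ?coprime_partC.
Qed.

Lemma mem1_regular (n : nat) : (0 < n)%N -> 1%N \in A n.
Proof.
elim/ltn_ind: n => n IHn n_gt0.
have [n_le1|n_gt1] := leqP n 1.
  by rewrite (_ : n = 1%N) ?(regular1 rA) ?inE //; lia.
have p_pr := pdiv_prime n_gt1; have p_dv := pdiv_dvd n.
set p := pdiv n in p_pr p_dv.
have a_gt0 : (0 < logn p n)%N by rewrite logn_gt0 mem_primes p_pr n_gt0.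
rewrite (regular_partn n p n_gt0); apply/imfset2P; exists 1%N => /=.
  by rewrite p_part; apply/mem_pfactorP => //; exists 0%N.
exists 1%N => //=; apply: IHn; rewrite ?part_gt0 //.
rewrite -{2}(partnC p n_gt0) ltn_Pmull ?part_gt0 // p_part.
by rewrite -(exp1n (logn p n)) ltn_exp2r ?prime_gt1.
Qed.

Lemma pfactor_type_mem (n p : nat) : (0 < n)%N -> p \in primes n ->
  (p ^ type_of A p (logn p n))%N \in A n.
Proof.
move=> n_gt0 p_n; have := p_n; rewrite mem_primes => /and3P[p_pr _ _].
have a_gt0 : (0 < logn p n)%N by rewrite logn_gt0.
rewrite (regular_partn n p n_gt0); apply/imfset2P => /=.
exists (p ^ type_of A p (logn p n))%N.
  rewrite p_part; apply/mem_pfactorP => //; exists 1%N; rewrite ?mul1n //.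
  by have /andP[t_gt0 t_le] := type_of_bounds _ _ p_pr a_gt0; rewrite divn_gt0.
by exists 1%N; rewrite ?muln1 // mem1_regular ?part_gt0.
Qed.

(** Split [d] into an element [p ^ (k * t)] of [A] at the [p]-part of [n] and a cofactor coprime to
    [p]; then [p %| d] forces [k] to be positive. *)
Lemma dvdn_pfactor_type (n d p : nat) : (0 < n)%N -> d \in A n ->
  prime p -> (p %| d)%N -> (p ^ type_of A p (logn p n) %| d)%N.
Proof.
move=> n_gt0 dA p_pr p_d; have p_n := dvdn_trans p_d (regular_dvd rA n_gt0 dA).
have a_gt0 : (0 < logn p n)%N by rewrite logn_gt0 mem_primes p_pr n_gt0.
move: dA p_d; rewrite {1}(regular_partn n p n_gt0).
case/imfset2P => /= d1; rewrite p_part => /mem_pfactorP[] // k _ -> [e eA ->].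
have p_e : coprime p e.
  have e_dv := regular_dvd rA (part_gt0 _ _) eA.
  apply: coprime_dvdr e_dv _.
  by apply: (@pnat_coprime p); rewrite ?pnat_id ?part_pnat.
rewrite Gauss_dvdl //; case: k => [|k _]; first by rewrite Euclid_dvd1.
by rewrite mulSn expnD -mulnA dvdn_mulr.
Qed.

Lemma gcdA_eq1P (j n : nat) : (0 < n)%N ->
  reflect {in primes n, forall p, ~~ (p ^ type_of A p (logn p n) %| j)%N}
          (gcdA A j%:Z n == 1%N).
Proof.
(* An empty maximum would be 0; membership of 1 in [A n] gives the lower bound. *)
move=> n_gt0; have gcd_gt0 : (0 < gcdA A j%:Z n)%N.
  exact: (@leq_bigmax_seq _ _ _ (fun d => d) 1%N (mem1_regular _ n_gt0)).
rewrite eqn_leq gcd_gt0 andbT.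
apply: (iffP (bigmax_leqP_seq _ _ _ _)) => [le1 p p_n|ndv d dA].
  apply/negP => pt_j; have := le1 _ (pfactor_type_mem _ _ n_gt0 p_n).
  rewrite dvdzE /= => /(_ pt_j); apply/negP; rewrite -ltnNge.
  have := p_n; rewrite mem_primes => /and3P[p_pr _ _].
  have /andP[t_gt0 _] : (0 < type_of A p (logn p n) <= logn p n)%N.
    by rewrite type_of_bounds ?logn_gt0.
  by rewrite -(exp1n (type_of A p (logn p n))) ltn_exp2r ?prime_gt1.
(* A common divisor [d > 1] has a prime factor [p], and then [p ^ t] divides [d], hence [j]. *)
rewrite dvdzE /= => d_j; rewrite leqNgt; apply/negP => d_gt1.
have p_pr := pdiv_prime d_gt1; have p_d := pdiv_dvd d.
have p_n : pdiv d \in primes n.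
  by rewrite mem_primes p_pr n_gt0 (dvdn_trans p_d) ?(regular_dvd rA).
by have /negP[] := ndv _ p_n; apply: dvdn_trans d_j; apply: dvdn_pfactor_type.
Qed.

(** The factors of the core are powers of distinct primes, so they are pairwise coprime. *)
Lemma coreA_dvdP (n q : nat) :
  reflect {in primes n, forall p,
             p ^ (logn p n - type_of A p (logn p n) + 1) %| q}%N
          (coreA A n %| q)%N.
Proof.
apply: (iffP (Gauss_dvd_prod _ _)) => [|h p p_n|h p p_n _]; try exact: h.
rewrite filter_predT pairwise_map.
apply: (@sub_in_pairwise _ (mem (primes n)) [rel x y | x != y]).
- move=> p p' /=; rewrite !mem_primes => /and3P[p_pr _ _] /and3P[p'_pr _ _] ne.
  by rewrite coprimeXl // coprimeXr // prime_coprime // dvdn_prime2.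
- exact/allP.
by rewrite -uniq_pairwise primes_uniq.
Qed.

Lemma gcdA_eq1 (j n : nat) : (0 < n)%N ->
  (gcdA A j%:Z n == 1%N) = (coreA A n %| n %/ gcdn j n)%N.
Proof.
move=> n_gt0.
suff E p : p \in primes n -> ~~ (p ^ type_of A p (logn p n) %| j)%N =
    (p ^ (logn p n - type_of A p (logn p n) + 1) %| n %/ gcdn j n)%N.
  apply/gcdA_eq1P/coreA_dvdP => // h p p_n.
    by rewrite -E //; apply: h.
  by rewrite E //; apply: h.
move=> p_n; have := p_n; rewrite mem_primes => /and3P[p_pr _ _].
have /andP[t_gt0 t_le] : (0 < type_of A p (logn p n) <= logn p n)%N.
  by rewrite type_of_bounds ?logn_gt0.
have g_gt0 : (0 < gcdn j n)%N by rewrite gcdn_gt0 n_gt0 orbT.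
have q_gt0 : (0 < n %/ gcdn j n)%N.
  by rewrite divn_gt0 // (dvdn_leq n_gt0 (dvdn_gcdr j n)).
(* Since [t <= logn p n], the power [p ^ t] divides [n], so [j] may be replaced by [gcdn j n]. *)
have -> : (p ^ type_of A p (logn p n) %| j)%N =
          (p ^ type_of A p (logn p n) %| gcdn j n)%N.
  by rewrite dvdn_gcd [X in _ && X]pfactor_dvdn // t_le andbT.
rewrite !pfactor_dvdn //.
(* With [a], [g] the valuations of [n] and [gcdn j n], the claim reads [g < t] iff
   [a - t + 1 <= a - g], where [t <= a] keeps the subtraction exact. *)
have : logn p n = (logn p (n %/ gcdn j n) + logn p (gcdn j n))%N.
  by rewrite -lognM // divnK ?dvdn_gcdr.
lia.
Qed.

End RegularSystem.

Theorem theorem2 (R : realType) (A : divisor_family) (n : nat)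
    (hA : regular_system A) (hn : (0 < n)%N) :
  cyclotomicA R A n =
  \prod_(d <- divisors n | (coreA A n %| d)%N)
     map_poly (intr : int -> R[i]) 'Phi_d.
Proof.
have prim_z := zeta_prim_root R n hn.
transitivity (\prod_(d <- divisors n | (coreA A n %| d)%N)
                 cyclotomic (zeta R n ^+ (n %/ d)) d).
  rewrite prod_cyclotomic_cond // /cyclotomicA.
  under eq_bigl do rewrite gcdA_eq1 //.
  rewrite -(big_mkord (fun k => coreA A n %| n %/ gcdn k n)%N
                      (fun k => 'X - (zeta R n ^+ k)%:P)).
  (* The ranges 1 to [n] and 0 to [n - 1] differ only in [j = n] against [k = 0]: both have gcd [n]
     with [n] and give the root 1. *)
  rewrite big_mkcond [RHS]big_mkcond /= big_nat_recr //= [RHS]big_ltn // mulrC.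
  by rewrite gcdnn gcd0n prim_expr_order // expr0.
rewrite big_seq_cond [RHS]big_seq_cond; apply: eq_bigr => d.
rewrite -dvdn_divisors // => /andP[d_dv _].
by rewrite (map_Cyclotomic _ _ _ (dvdn_prim_root prim_z d_dv)).
Qed.
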